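(* Let $P$ be a finite poset. Then there exists a constant $C_P$ (depending only on $P$) with the following property. Let $k$ and $n$ be positive integers with $n \ge \dim P$, and let $w$ be the width of the grid $[k]^n$. If $S \subseteq [k]^n$ does not contain a copy of $P$, then $|S| \le C_P\, w$.
   Context: For a positive integer $k$, $[k]=\{1,\dots,k\}$. The grid $[k]^n$ is the set of $n$-tuples with entries in $[k]$, ordered pointwise: $(x_1,\dots,x_n)\le(y_1,\dots,y_n)$ iff $x_i\le y_i$ for all $i\in[n]$. If $P,Q$ are posets, a subset $P'\subseteq Q$ is a copy of $P$ if the subposet of $Q$ induced on $P'$ is isomorphic to $P$. The width $w(Q)$ of a poset $Q$ is the size of its largest antichain. The (Dushnik–Miller) dimension $\dim P$ is the smallest positive integer $d$ for which there exist bijections $L_1,\dots,L_d:P\to[|P|]$ such that for all $p,q\in P$, $p\le_P q$ iff $L_i(p)\le L_i(q)$ for every $i\in[d]$. *)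

(* Defs.v *)
From HB Require Import structures.
From mathcomp Require Import all_boot all_order.
From Stdlib Require Import ClassicalEpsilon.
Set Implicit Arguments. Unset Strict Implicit. Unset Printing Implicit Defensive.
Import Order.TTheory.
Local Open Scope order_scope.

(* The grid [k]^n, with [k] represented by 'I_k = {0,...,k-1} (order-isomorphic
   to {1,...,k}).  Points are finite functions 'I_n -> 'I_k. *)
Definition grid (n k : nat) := {ffun 'I_n -> 'I_k}.

Definition gle (n k : nat) (x y : grid n k) : bool := [forall i, (x i <= y i)%N].

Definition gantichain (n k : nat) (A : {set grid n k}) : bool :=
  [forall x in A, forall y in A, gle x y ==> (x == y)].

Definition grid_width (n k : nat) : nat :=
  \max_(A : {set grid n k} | gantichain A) #|A|.

Definition has_copy (d : Order.disp_t) (P : finPOrderType d) (n k : nat)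
  (S : {set grid n k}) : Prop :=
  exists P' : {set grid n k}, P' \subset S /\
    exists f : P -> grid n k,
      [/\ injective f, f @: [set: P] = P' &
          forall p q : P, (p <= q) = gle (f p) (f q)].

(* realizers of size D: bijections L_1,...,L_D : P -> [|P|] (injective maps
   into a set of the same size, i.e. bijections) with p <= q iff L_i p <= L_i q
   for all i. *)
Definition has_realizer (d : Order.disp_t) (P : finPOrderType d) (D : nat) : bool :=
  (0 < D)%N &&
  [exists L : {ffun 'I_D -> {ffun P -> 'I_#|P|}},
     [forall i, injectiveb (L i)] &&
     [forall p : P, forall q : P, (p <= q) == [forall i, (L i p <= L i q)%N]]].

(* Dushnik--Miller dimension: least D with a realizer of size D
   (a realizer always exists; the fallback 0 is never used). *)
Definition dimension (d : Order.disp_t) (P : finPOrderType d) : nat :=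
  match excluded_middle_informative (exists D, has_realizer P D) with
  | left H => ex_minn H
  | right _ => 0
  end.

(* Main.v *)
Require Import Defs.
From HB Require Import structures.
From mathcomp Require Import all_boot all_order.
From mathcomp Require Import all_algebra zify ring.
Set Implicit Arguments. Unset Strict Implicit. Unset Printing Implicit Defensive.
Import Order.TTheory.

(** Let D = dim P.  Split the n coordinates into D blocks of about n/D
coordinates and decompose the grid of each block into symmetric chains; then
[k]^n is partitioned into products of D chains, i.e. into D-dimensional boxes.
A realizer turns P into a D-dimensional permutation pattern, so by the theorem
of Marcus-Tardos and Klazar-Marcus a set avoiding P meets a box with sides
l_1, ..., l_D in at most c * sum_j prod_(i != j) l_i points.  Since every
symmetric chain meets the middle level exactly once, the sum of
prod_(i != j) l_i over all boxes counts the points whose j-th block lies in its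
middle level, that is k^(n-m) a_m, where m is the size of the block and a_m the
size of the middle level of [k]^m.

The level sizes of [k]^m are symmetric and log-concave, whence
8 a_(2m) >= k^m a_m: below half of the maximum they decay geometrically, so the
sum of their squares, which is a_(2m), is comparable to a_m times their sum.
Iterating until the dimension exceeds n gives k^(n-m) a_m <= C * width, because
each level of [k]^n is an antichain. *)

(** * Log-concavity and level sizes *)

(** Stronger than [a s * a s.+2 <= a s.+1 ^ 2]: this form also forbids internal zeros, and it passes
    to sums over windows. *)
Definition log_concave (a : nat -> nat) :=
  forall u v i, u <= v -> a u * a (v + i) <= a (u + i) * a v.

Lemma log_concave_window (a : nat -> nat) k :
  log_concave a -> log_concave (fun s => \sum_(j < k) a (s + j)).
Proof.
case: k => [|k] lca; first by move=> u v i _; rewrite !big_ord0.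
set b := fun s => _.
have step s t : s <= t -> b s * b t.+1 <= b s.+1 * b t.
  move=> le_st.
  (* [B r] is the part shared by the windows at r and [r.+1]. After expansion [B s * B t] cancels,
     and [h1], [h2], [h3] bound the other three terms. *)
  pose B r := \sum_(j < k) a (r + j.+1).
  have b0 r : b r = a r + B r by rewrite /b big_ord_recl addn0.
  have b1 r : b r.+1 = B r + a (r + k.+1).
    rewrite /b big_ord_recr addSnnS; congr (_ + _).
    by apply: eq_bigr => j _ /=; rewrite addSnnS.
  rewrite b1 [b s]b0 b1 [b t]b0.
  have h1 : a s * a (t + k.+1) <= a (s + k.+1) * a t by apply: lca.
  have h2 : a s * B t <= B s * a t.
    by rewrite /B big_distrr big_distrl; apply: leq_sum => j _; apply: lca.
  have h3 : B s * a (t + k.+1) <= a (s + k.+1) * B t.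
    rewrite /B big_distrl big_distrr; apply: leq_sum => j _ /=.
    have := @lca (s + j.+1) (t + j.+1) (k - j); rewrite leq_add2r => /(_ le_st).
    by rewrite -!addnA (_ : j.+1 + (k - j) = k.+1) //; have := ltn_ord j; lia.
  nia.
move=> u v i; elim: i u v => [|i IH] u v le_uv; first by rewrite !addn0.
have [->|lt_uv] := eqVneq u v; first by rewrite mulnC.
rewrite addnS; apply: (leq_trans (step _ _ _)); first by lia.
by rewrite addnS -addSn; apply: IH; lia.
Qed.

(* With T the first point where g drops below g(0)/2, log-concavity gives
   2 g(s+T) <= g(s), so the first T terms carry half of the sum. *)
Lemma log_concave_tail (g : nat -> nat) L :
  log_concave g -> (forall s, L <= s -> g s = 0) ->
  g 0 * \sum_(s < L) g s <= 4 * \sum_(s < L) g s ^ 2.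
Proof.
move=> lcg g0.
have [->|g_gt0] := posnP (g 0); first by [].
have exT : exists T, 2 * g T < g 0 by exists L; rewrite g0.
case: (ex_minnP exT) => T gT minT.
have le_TL : T <= L by apply: minT; rewrite g0.
have half s : 2 * g (s + T) <= g s.
  have := lcg 0 s T isT; rewrite add0n => h; nia.
have sumT : \sum_(s < L) g s <= 2 * \sum_(s < T) g s.
  rewrite -!(big_mkord xpredT g) (big_cat_nat (leq0n T) le_TL) //=.
  have : 2 * \sum_(T <= i < L) g i <= \sum_(0 <= i < L) g i.
    rewrite -{1}(add0n T) big_addn big_distrr /=.
    rewrite (big_cat_nat (leq0n (L - T)) (leq_subr T L)) //=.
    apply: leq_trans (leq_addr _ _); apply: leq_sum => i _; exact: half.
  by rewrite (big_cat_nat (leq0n T) le_TL) //=; lia.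
have : g 0 * \sum_(s < T) g s <= 2 * \sum_(s < T) g s ^ 2.
  rewrite !big_distrr; apply: leq_sum => i _ /=.
  have : g 0 <= 2 * g i by rewrite leqNgt; apply/negP => /minT; rewrite leqNgt ltn_ord.
  nia.
have : \sum_(s < T) g s ^ 2 <= \sum_(s < L) g s ^ 2.
  rewrite -!(big_mkord xpredT (fun s => g s ^ 2)) (big_cat_nat (leq0n T) le_TL) //=.
  exact: leq_addr.
nia.
Qed.

Section LevelSizes.
Variable k : nat.
Import GRing.Theory.

(** Generating polynomial of one coordinate: the coefficients of its n-th power count points by
    coordinate sum, and products of grids become products of polynomials. *)
Definition level_poly : {poly nat} := (\sum_(a < k) 'X^a)%R.
Definition level_size n s : nat := ((level_poly ^+ n)`_s)%R.

Lemma ord_le_pred (a : 'I_k) : a <= k.-1.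
Proof. by case: a => a /=; lia. Qed.

Lemma card_block_level n (J : {set 'I_n}) s :
  #|[set x : grid n k | \sum_(i in J) (x i : nat) == s]|
  = level_size #|J| s * k ^ (n - #|J|).
Proof.
(* A coordinate outside J has weight 1 for each of its k values and so contributes the constant
   factor k. *)
pose F (i : 'I_n) (a : 'I_k) : {poly nat} := (if i \in J then 'X^a else 1)%R.
have E : (\prod_i \sum_a F i a = level_poly ^+ #|J| *+ (k ^ (n - #|J|)))%R.
  rewrite (bigID (mem J)) /= (eq_bigr (fun=> level_poly)); last first.
    by move=> i iJ; apply: eq_bigr => a _; rewrite /F iJ.
  rewrite prodr_const (eq_bigr (fun=> k%:R%R)); last first.
    by move=> i /negPf iJ; rewrite /F iJ sumr_const card_ord.
  rewrite prodr_const -natrX mulr_natr; congr (_ *+ (_ ^ _))%R.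
  have := cardC J; rewrite card_ord => h.
  by rewrite -[LHS](addKn #|J|); congr (_ - _).
have : ((\prod_i \sum_a F i a)`_s)%R = level_size #|J| s * k ^ (n - #|J|).
  by rewrite E coefMn -mulr_natr natn.
move=> <-; rewrite bigA_distr_bigA coef_sum -sum1_card big_mkcond /=.
apply: eq_bigr => x _; rewrite inE.
have -> : (\prod_i F i (x i) = 'X^(\sum_(i in J) (x i : nat)))%R.
  by rewrite -prodrXr /F -big_mkcond.
by rewrite coefXn eq_sym; case: eqP.
Qed.

Lemma card_level n s :
  #|[set x : grid n k | \sum_i (x i : nat) == s]| = level_size n s.
Proof.
have := card_block_level [set: 'I_n] s.
rewrite cardsT card_ord subnn muln1 => <-; apply: eq_card => x.
by rewrite !inE; congr (_ == _); apply: eq_bigl => i; rewrite inE.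
Qed.

Lemma level_size_sym n s :
  s <= n * k.-1 -> level_size n (n * k.-1 - s) = level_size n s.
Proof.
move=> le_s; rewrite -!card_level.
pose rv (x : grid n k) : grid n k := [ffun i => rev_ord (x i)].
have rvK : involutive rv by move=> x; apply/ffunP => i; rewrite !ffunE rev_ordK.
have sum_rv x : \sum_i (rv x i : nat) + \sum_i (x i : nat) = n * k.-1.
  rewrite -big_split -[n in RHS]card_ord -sum_nat_const; apply: eq_bigr => i _ /=.
  by rewrite ffunE /=; have := ltn_ord (x i); lia.
rewrite -(card_imset _ (can_inj rvK)); apply: eq_card => x.
apply/imsetP/idP => [[y]|]; rewrite !inE.
  by move=> /eqP hy ->; have := sum_rv y; lia.
by move=> /eqP hx; exists (rv x); rewrite ?rvK // inE; have := sum_rv x; lia.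
Qed.

Lemma level_size_out n s : n * k.-1 < s -> level_size n s = 0.
Proof.
move=> lt_s; rewrite -card_level; apply: eq_card0 => x; rewrite !inE.
apply: negbTE; rewrite neq_ltn (leq_ltn_trans _ lt_s) //.
rewrite -[n in leqRHS]card_ord -sum_nat_const; apply: leq_sum => i _ /=.
exact: ord_le_pred.
Qed.

Lemma level_size_sum n L : n * k.-1 < L -> \sum_(s < L) level_size n s = k ^ n.
Proof.
move=> lt_L.
have E (x : grid n k) : \sum_i (x i : nat) < L.
  apply: leq_ltn_trans lt_L.
  rewrite -[n in leqRHS]card_ord -sum_nat_const; apply: leq_sum => i _ /=.
  exact: ord_le_pred.
rewrite -[k in RHS]card_ord -[n in RHS]card_ord -card_ffun -sum1_card.
rewrite (partition_big (fun x : grid n k => Ordinal (E x)) predT) //=.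
apply: eq_bigr => s _; rewrite -card_level -sum1_card; apply: eq_bigl => x.
by rewrite inE.
Qed.

Lemma level_size_log_concave n : log_concave (level_size n).
Proof.
elim: n => [|n IH].
  move=> u v i _; rewrite /level_size expr0 !coef1.
  by case: u => [|u]; case: v => [|v]; case: i => [|i].
(* Padding with k zeros lets the window of the k levels ending at s start at index [s.+1], free of
   truncated subtraction. *)
pose a s := if s < k then 0 else level_size n (s - k).
have lca : log_concave a.
  move=> u v i le_uv; rewrite /a.
  have [//|le_ku] := ltnP u k.
  have [|_] := ltnP (u + i) k; first by lia.
  have [|le_kv] := ltnP v k; first by lia.
  have [|_] := ltnP (v + i) k; first by lia.
  by rewrite -!addnBAC //; apply: IH; lia.
move=> u v i le_uv.
have E s : level_size n.+1 s = \sum_(j < k) a (s.+1 + j).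
  rewrite /level_size exprS /level_poly mulr_suml coef_sum.
  rewrite (reindex_inj rev_ord_inj) /=; apply: eq_bigr => j _.
  rewrite coefXnM /a; have := ltn_ord j => lt_jk.
  have -> : (s.+1 + j < k) = (s < k - j.+1) by lia.
  by case: ifP => // _; congr (level_size n _); lia.
rewrite !E -!addSn; exact: (log_concave_window k lca).
Qed.

Lemma level_sizeD m n s :
  level_size (m + n) s = \sum_(i < s.+1) level_size m i * level_size n (s - i).
Proof. by rewrite /level_size exprD coefM. Qed.

(** The convolution pairs level s with its mirror image, of equal size, and so is a sum of squares.
    Folding the levels below the middle onto those above costs a factor 2, and [log_concave_tail]
    the factor 4. *)
Lemma level_size_double n :
  k ^ n * level_size n (n * k.-1)./2 <= 8 * level_size (n + n) (n * k.-1).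
Proof.
set M := n * k.-1; set r := M./2.
have def_M : M = r + r + odd M by rewrite addnn addnC odd_double_half.
pose g s := level_size n (r + s).
have lcg : log_concave g.
  by move=> u v i le_uv; rewrite /g !addnA; apply: level_size_log_concave; lia.
pose L := (odd M).+1 + r.
have M1 : M.+1 = r + L by rewrite /L; lia.
have low : \sum_(s < r) level_size n s <= \sum_(s < L) g s.
  rewrite [leqRHS]big_split_ord /=; apply: leq_trans (leq_addl _ _).
  rewrite (reindex_inj rev_ord_inj) /=; apply: leq_sum => j _; rewrite /g.
  rewrite -level_size_sym -/M; last by have := ltn_ord j; lia.
  by apply: eq_leq; congr level_size; have := ltn_ord j; lia.
have <- : \sum_(s < M.+1) level_size n s = k ^ n by exact: level_size_sum.
have tail : g 0 * \sum_(s < L) g s <= 4 * \sum_(s < L) g s ^ 2.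
  apply: log_concave_tail => // s le_s; apply: level_size_out.
  by rewrite -/M; lia.
have sq : \sum_(s < L) g s ^ 2 <= level_size (n + n) M.
  rewrite level_sizeD M1 [leqRHS]big_split_ord /=; apply: leq_trans (leq_addl _ _).
  apply: leq_sum => j _; rewrite /g level_size_sym //.
  by rewrite -/M; have := ltn_ord j; lia.
have g0 : g 0 = level_size n r by rewrite /g addn0.
rewrite M1 big_split_ord /= -g0.
have : \sum_(i < r) level_size n i + \sum_(i < L) g i <= 2 * \sum_(i < L) g i.
  by rewrite mul2n -addnn leq_add2r.
move=> half; apply: leq_trans (leq_mul half (leqnn (g 0))) _.
have : 2 * (g 0 * \sum_(i < L) g i) <= 2 * (4 * level_size (n + n) M).
  by rewrite leq_mul2l /=; apply: leq_trans tail _; rewrite leq_mul2l sq orbT.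
by rewrite mulnA [2 * _ * _]mulnAC mulnA.
Qed.

Lemma level_size_le_width n s : level_size n s <= grid_width n k.
Proof.
rewrite -card_level /grid_width; apply: leq_bigmax_cond.
apply/forall_inP => x; rewrite inE => /eqP hx; apply/forall_inP => y.
rewrite inE => /eqP hy; apply/implyP => /forallP le_xy.
apply/eqP/ffunP => i; apply/val_inj/eqP; rewrite eqn_leq le_xy /=.
have : \sum_i (y i - x i) = 0.
  by rewrite sumnB // hx hy subnn.
by move/eqP; rewrite sum_nat_eq0 => /forallP/(_ i); rewrite subn_eq0.
Qed.

(** Doubling e times leads to N = 2^e m >= n coordinates. Fixing N - n of them cuts a level of [k]^N
    into at most k^(N-n) levels of [k]^n, each bounded by the width; then k^(N-n) cancels. *)
Lemma level_size_width m n e : 0 < k -> m <= n -> n <= 2 ^ e * m ->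
  k ^ (n - m) * level_size m (m * k.-1)./2 <= 8 ^ e * grid_width n k.
Proof.
move=> k_gt0 le_mn le_n.
pose N := 2 ^ e * m; pose mid m := level_size m (m * k.-1)./2.
have le_mN : m <= N by apply: leq_trans le_n.
have dbl : k ^ (N - m) * mid m <= 8 ^ e * mid N.
  rewrite /N; elim: (e) => [|f IH]; first by rewrite mul1n subnn.
  set N0 := 2 ^ f * m in IH *.
  have -> : 2 ^ f.+1 * m = N0 + N0 by rewrite expnS /N0; lia.
  have le_m : m <= N0 by rewrite leq_pmull ?expn_gt0.
  have -> : N0 + N0 - m = N0 + (N0 - m) by lia.
  rewrite expnD -mulnA; apply: leq_trans (leq_mul (leqnn _) IH) _.
  rewrite mulnCA expnSr -mulnA leq_mul2l; apply/orP; right.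
  have mid2 : ((N0 + N0) * k.-1)./2 = N0 * k.-1 by rewrite mulnDl addnn doubleK.
  by rewrite /mid mid2; apply: level_size_double.
have wN : mid N <= k ^ (N - n) * grid_width n k.
  rewrite /mid; set s := _./2; rewrite -{1}(subnKC (le_n : n <= N)).
  rewrite level_sizeD.
  have tot : \sum_(i < s.+1) level_size (N - n) i <= k ^ (N - n).
    rewrite -(@level_size_sum (N - n) (s.+1 + ((N - n) * k.-1).+1)); last by lia.
    by rewrite big_split_ord leq_addr.
  apply: leq_trans (leq_mul tot (leqnn (grid_width n k))).
  rewrite big_distrl (reindex_inj rev_ord_inj) /=; apply: leq_sum => i _.
  rewrite mulnC leq_mul ?level_size_le_width //.
  by apply: eq_leq; congr level_size; have := ltn_ord i; lia.
rewrite -(@leq_pmul2l (k ^ (N - n))) ?expn_gt0 ?k_gt0 // mulnA -expnD.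
have -> : N - n + (n - m) = N - m by lia.
apply: leq_trans dbl _; rewrite mulnCA leq_mul2l wN orbT //.
Qed.

End LevelSizes.

(** * Symmetric chains *)

Section SymmetricChains.
Variable K : nat.

(* The symmetric chain decomposition of {0..K}^m of de Bruijn, Tengbergen and
   Kruyswijk.  A chain c_0 < ... < c_h of the tail, multiplied by {0..K}, splits
   into the hooks (0,c_j), ..., (K-j,c_j), (K-j,c_{j+1}), ..., (K-j,c_h).
   [chain_label] records the hook chosen at each step and so names the chain
   containing y, [chain_pos] is the index of y in it, and [chain_height] is the
   index of its last element. *)
Fixpoint chain_pos (y : seq nat) : nat :=
  if y is a :: t then a + (chain_pos t - (K - a)) else 0.

Fixpoint chain_label (y : seq nat) : seq nat :=
  if y is a :: t then minn (chain_pos t) (K - a) :: chain_label t else [::].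

Fixpoint chain_height (l : seq nat) : nat :=
  if l is j :: l' then chain_height l' + K - j.*2 else 0.

Implicit Types y z : seq nat.
Definition bounded := all (fun a => a <= K).

Lemma chain_pos_le y : bounded y -> chain_pos y <= chain_height (chain_label y).
Proof. by elim: y => //= a y IH /andP[le_a /IH]; lia. Qed.

Lemma sumn_chain y : bounded y -> sumn y = chain_pos y + sumn (chain_label y).
Proof. by elim: y => //= a y IH /andP[le_a /IH]; lia. Qed.

(** This is the symmetry of the chain: by [sumn_chain] its lowest rank is the sum of the label, and
    its lowest and highest ranks add up to K times the length. *)
Lemma chain_heightE y : bounded y ->
  chain_height (chain_label y) + (sumn (chain_label y)).*2 = K * size y.
Proof.
elim: y => [|a y IH] /=; first by rewrite muln0.
by case/andP => le_a by_; have := IH by_; have := chain_pos_le by_; lia.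
Qed.

Lemma chain_leq y z : bounded y -> bounded z -> size y = size z ->
  chain_label y = chain_label z -> chain_pos y <= chain_pos z ->
  all2 leq y z.
Proof.
elim: y z => [|a y IH] [|b z] //= /andP[le_a by_] /andP[le_b bz] [szE] [hE lE] le_p.
by apply/andP; split; [lia | apply: IH => //; lia].
Qed.

Lemma chain_fill y v : bounded y -> v <= chain_height (chain_label y) ->
  exists z, [/\ bounded z, size z = size y, chain_label z = chain_label y &
                chain_pos z = v].
Proof.
elim: y v => [|a y IH] v /=; first by move=> _; case: v => // _; exists [::].
case/andP => le_a by_ le_v; have le_p := chain_pos_le by_.
set j := minn _ _ in le_v *.
(* Up to [K - j] the head climbs while the tail stays at position j; afterwards the head rests at
   [K - j] and the tail climbs. *)
have [le_vK|lt_Kv] := leqP v (K - j).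
  have [z [bz sz lz pz]] := IH j by_ ltac:(lia).
  by exists (v :: z); rewrite /= bz sz lz pz; split=> //; [lia|congr (_ :: _)|]; lia.
have [z [bz sz lz pz]] := IH (v - (K - j) + j) by_ ltac:(lia).
exists (K - j :: z); rewrite /= bz sz lz pz; split=> //; [lia|congr (_ :: _)|]; lia.
Qed.

Lemma sumn_chain_mid y : bounded y ->
  chain_pos y = (chain_height (chain_label y))./2 -> sumn y = (size y * K)./2.
Proof. by move=> by_; rewrite sumn_chain // mulnC -chain_heightE //; lia. Qed.

End SymmetricChains.

(** * The Marcus-Tardos theorem in boxes *)

Lemma size_le_sum_fibers (T U : eqType) (f : T -> U) (s : seq T) (r : seq U) :
  {in s, forall x, f x \in r} ->
  size s <= \sum_(u <- r) count (fun x => f x == u) s.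
Proof.
elim: s => [|x s IH] fr //=.
rewrite big_split /= -add1n leq_add //.
  by rewrite (big_rem (f x)) ?fr ?mem_head //= eqxx leq_addr.
by apply: IH => y ys; apply: fr; rewrite inE ys orbT.
Qed.

Lemma card_family_prod (I T : finType) (F : I -> {set T}) :
  #|[set f : {ffun I -> T} | [forall i, f i \in F i]]| = \prod_i #|F i|.
Proof.
under [RHS]eq_bigr do rewrite -sum1_card.
rewrite bigA_distr_big_dep /= -sum1_card.
rewrite [RHS](eq_bigr (fun=> 1)); last by move=> f _; rewrite big1.
by apply: eq_bigl => f; rewrite inE; apply/forallP/familyP.
Qed.

Section MarcusTardos.
Variables (D : nat) (P : finType) (L : 'I_D -> P -> 'I_#|P|).
Hypothesis P_gt0 : 0 < #|P|.

Notation pt := {ffun 'I_D -> nat}.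
Notation t := #|P|.
Implicit Types (x b : pt) (A B : seq pt) (J : {set 'I_D}).

(** Coordinates outside J are unconstrained, so shrinking J passes to lower-dimensional patterns
    without changing the type of points. *)
Definition contains_pattern J A := exists f : P -> pt,
  (forall p, f p \in A) /\
  (forall i p q, i \in J -> L i p < L i q -> f p i < f q i).

Definition in_box (l : 'I_D -> nat) x := [forall i, x i < l i].
(* Coordinates outside J are frozen at 0, so that an array indexed by J is a set
   of points of the full index type and deleting a coordinate is removing it
   from J. *)
Definition side J N := fun i : 'I_D => if i \in J then N else 1.

Definition cell s x : pt := [ffun i => x i %/ s].

Definition residues s A b i : {set 'I_s} :=
  [set r : 'I_s | has (fun x => (cell s x == b) && (x i %% s == r)) A].

Lemma contains_map J A B (g : pt -> pt) :
  (forall b, b \in B -> exists2 x, x \in A & g x = b) ->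
  (forall i x x', i \in J -> g x i < g x' i -> x i < x' i) ->
  contains_pattern J B -> contains_pattern J A.
Proof.
move=> gB gJ [f [fB fJ]].
have /fin_all_exists2[h hA hf] p := gB _ (fB p).
by exists h; split=> // i p q iJ lt_pq; apply: gJ => //; rewrite !hf fJ.
Qed.

Lemma sorted_enum_ord s (R : {set 'I_s}) : sorted ltn (map val (enum R)).
Proof.
rewrite sorted_map; have -> : enum R = filter (mem R) (enum 'I_s).
  by rewrite {1}/enum_mem -enumT.
apply: sorted_filter; first by move=> ? ? ?; apply: ltn_trans.
by rewrite -sorted_map val_enum_ord iota_ltn_sorted.
Qed.

(** A pattern of cells lifts to points: in the cell [f p] choose a point whose residue in direction
    i is the element of R with index [L i p]. These residues order coordinate i, and the cells order
    all others. *)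
Lemma contains_wide J i s A B v (R : {set 'I_s}) : i \in J -> t <= #|R| ->
  {in B, forall b, b i = v /\ residues s A b i = R} ->
  contains_pattern (J :\ i) B -> contains_pattern J A.
Proof.
move=> iJ le_tR BR [f [fB fJ]].
pose c := map val (enum R).
have lt_c p : L i p < size c.
  by rewrite size_map -cardE; apply: leq_trans le_tR.
have ex p : exists2 x, x \in A & cell s x = f p /\ x i %% s = nth 0 c (L i p).
  have [_ resR] := BR _ (fB p).
  have /mapP[r] := mem_nth 0 (lt_c p).
  rewrite mem_enum -resR inE => /hasP[x xA /andP[/eqP cx /eqP rx]] ->.
  by exists x.
have /fin_all_exists2[h hA hP] := ex.
exists h; split=> // j p q jJ lt_pq.
have [hp rp] := hP p; have [hq rq] := hP q.
have [eq_ji|ne_ji] := eqVneq j i; last first.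
  have : f p j < f q j by apply: fJ => //; rewrite !inE ne_ji.
  rewrite -hp -hq !ffunE; apply: contraTT; rewrite -!leqNgt; exact: leq_div2r.
subst j; rewrite (divn_eq (h p i) s) (divn_eq (h q i) s).
have [fpi _] := BR _ (fB p); have [fqi _] := BR _ (fB q).
have -> : h p i %/ s = v by rewrite -fpi -hp ffunE.
have -> : h q i %/ s = v by rewrite -fqi -hq ffunE.
rewrite ltn_add2l rp rq.
apply: (sorted_ltn_nth ltn_trans 0 (sorted_enum_ord R)); rewrite ?inE //; exact: lt_c.
Qed.

(** A point is determined by its cell and its residues. *)
Lemma cell_count s A b : 0 < s -> uniq A ->
  count (fun x => cell s x == b) A <= \prod_i #|residues s A b i|.
Proof.
move=> s_gt0 uA; rewrite -card_family_prod cardE -size_filter.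
case: s s_gt0 b => // s _ b.
pose res x : {ffun 'I_D -> 'I_s.+1} := [ffun i => inord (x i %% s.+1)].
have res_val x i : res x i = x i %% s.+1 :> nat.
  by rewrite ffunE inordK // ltn_mod.
rewrite -(size_map res); apply: uniq_leq_size.
  rewrite map_inj_in_uniq ?filter_uniq // => x y.
  rewrite !mem_filter => /andP[/eqP cx _] /andP[/eqP cy _] eq_res.
  apply/ffunP => i; rewrite (divn_eq (x i) s.+1) (divn_eq (y i) s.+1).
  have := congr1 (fun z : pt => z i) (etrans cx (esym cy)); rewrite !ffunE => ->.
  by rewrite -!res_val eq_res.
move=> z /mapP[x + ->]; rewrite mem_filter => /andP[cx xA].
rewrite mem_enum inE; apply/forallP => i; rewrite inE.
by apply/hasP; exists x; rewrite // cx res_val eqxx.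
Qed.

(** The segment is a single cell of side N. More than t points would make it wide, and deleting its
    only coordinate leaves no constraint, so a constant map feeds [contains_wide]. *)
Lemma box_bound1 J : #|J| = 1 -> forall N A, 0 < N -> uniq A ->
  all (in_box (side J N)) A -> ~ contains_pattern J A -> size A <= t.
Proof.
move=> /eqP/cards1P[i ->] N A N_gt0 uA /allP boxA; apply: contra_notT.
rewrite -ltnNge => lt_tA.
have cell0 x : x \in A -> cell N x = [ffun=> 0].
  move=> /boxA/forallP bx; apply/ffunP => j; rewrite !ffunE divn_small //.
  by have := bx j; rewrite /side; case: ifP => // _; move/leq_trans; apply.
apply: (@contains_wide _ i N A [:: [ffun=> 0]] 0 (residues N A [ffun=> 0] i)).
- by rewrite inE.
- apply: leq_trans (ltnW lt_tA) _.
  have -> : size A = count (fun x => cell N x == [ffun=> 0]) A.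
    by apply/esym/eqP; rewrite -all_count; apply/allP => x /cell0 ->.
  apply: leq_trans (cell_count _ N_gt0 uA) _.
  rewrite (bigD1 i) //= -[leqRHS]muln1 leq_mul2l -[X in _ <= X](exp1n #|[pred j | j != i]|).
  rewrite -prod_nat_const; apply/orP; right; apply: leq_prod => j ne_ji.
  rewrite -[X in _ <= X](cards1 (Ordinal N_gt0)); apply/subset_leq_card/subsetP => r.
  rewrite !inE => /hasP[x /boxA/forallP/(_ j) + /andP[_ /eqP]].
  rewrite /side inE (negPf ne_ji) ltnS leqn0 => /eqP -> r0.
  by apply/eqP/val_inj; rewrite /= -r0 mod0n.
- by move=> b; rewrite inE => /eqP ->; rewrite ffunE.
- exists (fun=> [ffun=> 0]); split=> [p|j p q]; first by rewrite inE.
  by rewrite !inE; case: eqP.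
Qed.

Lemma in_box_cell J s e x : 0 < s ->
  in_box (side J (s ^ e.+1)) x -> in_box (side J (s ^ e)) (cell s x).
Proof.
move=> s_gt0 /forallP bx; apply/forallP => i; rewrite ffunE.
have := bx i; rewrite /side; case: ifP => _.
  by rewrite ltn_divLR // -expnSr.
by rewrite ltnS leqn0 => /eqP ->; rewrite div0n.
Qed.

Lemma residues_out J N s A b i : 0 < s -> all (in_box (side J N)) A ->
  i \notin J -> #|residues s A b i| <= 1.
Proof.
move=> s_gt0 /allP boxA iJ.
rewrite -[X in _ <= X](cards1 (Ordinal s_gt0)).
apply/subset_leq_card/subsetP => r.
rewrite !inE => /hasP[x /boxA/forallP/(_ i) + /andP[_ /eqP]].
rewrite /side (negPf iJ) ltnS leqn0 => /eqP -> r0.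
by apply/eqP/val_inj; rewrite /= -r0 mod0n.
Qed.

Lemma contains_cells J s A :
  contains_pattern J (undup (map (cell s) A)) -> contains_pattern J A.
Proof.
apply: contains_map (cell s) _ _ => [b|i x x' _].
  by rewrite mem_undup => /mapP[x xA ->]; exists x.
by rewrite !ffunE; apply: contraTT; rewrite -!leqNgt; apply: leq_div2r.
Qed.

Definition wide s A i b := t <= #|residues s A b i|.

Definition flatten_coord (i : 'I_D) b : pt := [ffun j => if j == i then 0 else b j].

(** Pigeonhole over N values of the i-th coordinate and [2 ^ s] residue sets; flattening coordinate
    i embeds each class in a box of lower dimension. *)
Lemma count_wide J i s N A B M : i \in J -> 0 < N -> ~ contains_pattern J A -> uniq B ->
  all (in_box (side J N)) B ->
  (forall A', uniq A' -> all (in_box (side (J :\ i) N)) A' ->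
     ~ contains_pattern (J :\ i) A' -> size A' <= M) ->
  count (wide s A i) B <= N * 2 ^ s * M.
Proof.
move=> iJ N_gt0 avoidA uB /allP boxB IH.
pose key b := (b i, residues s A b i).
pose r := [seq (v, R) | v <- iota 0 N, R <- enum {set 'I_s}].
have size_r : size r = N * 2 ^ s.
  by rewrite size_allpairs size_iota -cardE -cardsT -powersetT card_powerset cardsT card_ord.
rewrite -size_filter; set W := filter _ _.
have keyW : {in W, forall b, key b \in r}.
  move=> b; rewrite mem_filter => /andP[_ /boxB/forallP/(_ i)].
  rewrite /side iJ => lt_b; apply/allpairsP; exists (key b).
  by rewrite mem_iota mem_enum.
apply: leq_trans (size_le_sum_fibers keyW) _.
rewrite -size_r -sum1_size big_distrl /=; apply: leq_sum => -[v R] _; rewrite mul1n.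
rewrite -size_filter; set G := filter _ _.
have GP b : b \in G -> [/\ b i = v, residues s A b i = R, t <= #|R| & b \in B].
  by rewrite !mem_filter => /andP[/eqP[<- <-] /andP[]].
rewrite -(size_map (flatten_coord i)); apply: IH.
- rewrite map_inj_in_uniq ?filter_uniq // => b b' /GP[bi _ _ _] /GP[b'i _ _ _].
  move/ffunP => eq_f; apply/ffunP => j; have := eq_f j; rewrite !ffunE.
  by case: eqP => // -> _; rewrite bi b'i.
- apply/allP => _ /mapP[b /GP[_ _ _ /boxB/forallP bB] ->]; apply/forallP => j.
  have := bB j; rewrite /side ffunE !inE; case: eqP => //= _.
- move=> cG; apply: avoidA.
  (* As P is nonempty, G has a member, and its wideness bounds R from below. *)
  have le_t : t <= #|R|.
    have [f [fG _]] := cG; have /card_gt0P[p _] := P_gt0.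
    by have /mapP[b /GP[]] := fG p.
  apply: (@contains_wide J i s A G v R) => //; first by move=> b /GP[].
  apply: contains_map (flatten_coord i) _ _ cG => [b /mapP[x xG ->]|j b b']; first by exists x.
  by rewrite !inE !ffunE => /andP[/negPf ->].
Qed.

(* Cut the cube into cells of side s.  A cell which is wide in no direction has
   at most t^D points, and t^D < s; the cells that are wide in direction i and
   share their i-th coordinate and residue set avoid the pattern with coordinate
   i deleted.  The set of nonempty cells avoids the pattern as well. *)
Theorem marcus_tardos j : exists s c, forall J, #|J| = j.+1 -> forall e A, uniq A ->
  all (in_box (side J (s.+2 ^ e))) A -> ~ contains_pattern J A ->
  size A <= c * s.+2 ^ (e * j).
Proof.
(* The form [s'.+2] records that s is at least 2, as the logarithm to base s in [box_bound]
   requires. *)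
have [s' def_s] : exists s', t ^ D + 1 = s'.+2.
  have tD : 0 < t ^ D by rewrite expn_gt0 P_gt0.
  by exists (t ^ D).-1; lia.
exists s'; rewrite -def_s; set s := t ^ D + 1.
have s_gt0 : 0 < s by rewrite /s addn1.
elim: j => [|j [c IH]].
  exists t => J J1 e A uA boxA avoidA; rewrite muln0 muln1.
  by apply: box_bound1 boxA avoidA; rewrite // expn_gt0 s_gt0.
(* Let S = s^(e (j+1)). As s = t^D + 1, c' s S = c' t^D S + c' S: the first term pays t^D points for
   every cell, the second pays for the wide cells, and the summand 1 settles e = 0. *)
pose c' := D * (s ^ D * (2 ^ s * c)) + 1.
exists c' => J cardJ; elim=> [|e IHe] A uA boxA avoidA.
  rewrite mul0n muln1.
  apply: leq_trans (_ : 1 <= _); last by rewrite /c' addn1.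
  rewrite -(size_nseq 1 ([ffun=> 0] : pt)); apply: uniq_leq_size => // x.
  move=> /(allP boxA)/forallP bx; rewrite inE; apply/eqP/ffunP => i.
  have := bx i; rewrite /side expn0 ffunE if_same.
  by rewrite ltnS leqn0 => /eqP.
set B := undup (map (cell s) A).
have uB : uniq B by exact: undup_uniq.
have boxB : all (in_box (side J (s ^ e))) B.
  apply/allP => b; rewrite mem_undup => /mapP[x xA ->].
  by apply: in_box_cell => //; apply: (allP boxA).
have sizeB : size B <= c' * s ^ (e * j.+1).
  by apply: IHe => // /contains_cells.
have wideB i : i \in J -> count (wide s A i) B <= s ^ e * 2 ^ s * (c * s ^ (e * j)).
  move=> iJ; apply: (@count_wide J i s (s ^ e) A B _ iJ _ avoidA uB boxB); first by rewrite expn_gt0 s_gt0.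
  by move=> A'; apply: IH; move: (cardsD1 i J); rewrite iJ cardJ => -[].
have cellB : {in A, forall x, cell s x \in B}.
  by move=> x xA; rewrite mem_undup map_f.
apply: leq_trans (size_le_sum_fibers cellB) _.
have block b : count (fun x => cell s x == b) A
     <= t ^ D + \sum_(i in J) s ^ D * wide s A i b.
  apply: leq_trans (cell_count _ s_gt0 uA) _.
  have [/existsP[i /andP[iJ wi]]|/existsPn nw] := boolP [exists i, (i \in J) && wide s A i b].
    rewrite (bigD1 i iJ) /= wi muln1 addnCA; apply: leq_trans (leq_addr _ _).
    rewrite -[D in leqRHS]card_ord -prod_nat_const; apply: leq_prod => k _.
    by rewrite -[leqRHS]card_ord max_card.
  apply: leq_trans (leq_addr _ _).
  rewrite -[D in leqRHS]card_ord -prod_nat_const; apply: leq_prod => i _.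
  have := nw i; have [iJ|iJ _] := boolP (i \in J); first by rewrite -ltnNge => /ltnW.
  exact: leq_trans (residues_out _ s_gt0 boxA iJ) P_gt0.
apply: leq_trans (leq_sum _ (fun b _ => block b)) _.
rewrite big_split /= big_const_seq count_predT iter_addn_0 [t ^ D * _]mulnC exchange_big /=.
have sumJ : \sum_(i in J) \sum_(b <- B) s ^ D * wide s A i b
    <= D * (s ^ D * (s ^ e * 2 ^ s * (c * s ^ (e * j)))).
  have le_JD : #|J| <= D by rewrite -[leqRHS]card_ord max_card.
  apply: leq_trans (leq_mul le_JD (leqnn _)).
  rewrite -sum_nat_const; apply: leq_sum => i iJ.
  rewrite -big_distrr /= leq_mul2l; apply/orP; right.
  apply: leq_trans (wideB i iJ).
  by rewrite -sumn_count sumnE big_map.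
set S := s ^ (e * j.+1) in sizeB *.
have defS : S = s ^ e * s ^ (e * j) by rewrite -expnD -mulnS.
have le_s : s <= s ^ j.+1 by rewrite -{1}[s]expn1 leq_pexp2l.
rewrite mulSn expnD -/S.
apply: leq_trans (leq_add (leq_mul sizeB (leqnn _)) sumJ) _.
have -> : D * (s ^ D * (s ^ e * 2 ^ s * (c * s ^ (e * j)))) = D * (s ^ D * (2 ^ s * c)) * S.
  by rewrite defS; ring.
apply: leq_trans (_ : c' * (s * S) <= _); last by rewrite leq_mul2l leq_mul2r le_s !orbT.
have -> : c' * (s * S) = c' * S * t ^ D + c' * S.
  by rewrite /s mulnDl mul1n mulnDr mulnA mulnAC.
by rewrite leq_add2l leq_mul2r leq_addr orbT.
Qed.

(* Cut the box into cubes whose side is the largest power of s below the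
   shortest side of the box. *)
Lemma box_bound : 0 < D -> exists c, forall (l : 'I_D -> nat) A,
  (forall i, 0 < l i) -> uniq A -> all (in_box l) A ->
  ~ contains_pattern [set: 'I_D] A ->
  size A <= c * \sum_j \prod_(i | i != j) l i.
Proof.
move=> D_gt0; have [s' [c0 H]] := marcus_tardos D.-1.
have {}H := H [set: 'I_D] ltac:(by rewrite cardsT card_ord prednK).
(* [2 ^ D] pays for rounding up the number of cubes along each side, none being shorter than a cube,
   and s for the shortest side, which is below s times the cube side. *)
set s := s'.+2 in H; exists (c0 * 2 ^ D * s) => l A l_gt0 uA boxA avoidA.
have [j0 _ min_j] := arg_minnP l (isT : xpredT (Ordinal D_gt0)).
set m := l j0 in min_j; set e := trunc_log s m.
have m_gt0 : 0 < m by apply: l_gt0.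
have le_m : s ^ e <= m by apply: trunc_logP.
have lt_m : m < s ^ e.+1 by apply: trunc_log_ltn.
set q := s ^ e in le_m; have q_gt0 : 0 < q by rewrite expn_gt0.
suff : size A <= c0 * 2 ^ D * s * \prod_(i | i != j0) l i.
  by move/leq_trans; apply; apply: leq_mul => //; rewrite [leqRHS](bigD1 j0) //= leq_addr.
(* The extra factor q completes [q ^ D.-1] to one factor q for each side. *)
rewrite -(leq_pmul2r q_gt0).
pose F i : {set 'I_(\sum_j l j).+1} := [set a : 'I_(\sum_j l j).+1 | a < (l i %/ q).+1].
pose r := enum [set f : {ffun 'I_D -> 'I_(\sum_j l j).+1} | [forall i, f i \in F i]].
pose key x : {ffun 'I_D -> 'I_(\sum_j l j).+1} := [ffun i => inord (x i %/ q)].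
have key_val x i : x \in A -> key x i = x i %/ q :> nat.
  move=> /(allP boxA)/forallP/(_ i) lt_x; rewrite ffunE inordK // ltnS.
  apply: leq_trans (leq_div _ _) _; apply: leq_trans (ltnW lt_x) _.
  by rewrite (bigD1 i) //= leq_addr.
have keyr : {in A, forall x, key x \in r}.
  move=> x xA; rewrite mem_enum inE; apply/forallP => i; rewrite inE key_val //.
  by rewrite ltnS leq_div2r // ltnW //; apply: (forallP (allP boxA _ xA)).
have fib f : count (fun x => key x == f) A <= c0 * s ^ (e * D.-1).
  pose red x : pt := [ffun i => x i %% q].
  rewrite -size_filter -(size_map red); set G := filter _ _.
  have GP x : x \in G -> key x = f /\ x \in A.
    by rewrite mem_filter => /andP[/eqP].
  have Gdiv x y i : x \in G -> y \in G -> x i %/ q = y i %/ q.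
    by move=> /GP[kx xA] /GP[ky yA]; rewrite -!key_val // kx ky.
  apply: H.
  - rewrite map_inj_in_uniq ?filter_uniq // => x y xG yG /ffunP eq_r.
    apply/ffunP => i; have := eq_r i; rewrite !ffunE => eq_ri.
    by rewrite (divn_eq (x i) q) (divn_eq (y i) q) eq_ri (Gdiv x y).
  - apply/allP => _ /mapP[x xG ->]; apply/forallP => i.
    by rewrite /side inE ffunE ltn_mod.
  - move=> [h [hG hJ]]; apply: avoidA.
    have ex p : exists2 x, x \in G & red x = h p.
      by have /mapP[x xG ->] := hG p; exists x.
    have /fin_all_exists2[g gG gh] := ex.
    exists g; split=> [p|i p p' iT lt_p]; first by have [] := GP _ (gG p).
    have := hJ i p p' iT lt_p; rewrite -!gh !ffunE.
    by rewrite {2}(divn_eq (g p i) q) {2}(divn_eq (g p' i) q) (Gdiv _ (g p')) // ltn_add2l.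
apply: leq_trans (leq_mul (size_le_sum_fibers keyr) (leqnn _)) _.
apply: leq_trans (leq_mul (leq_sum _ (fun f _ => fib f)) (leqnn _)) _.
rewrite big_const_seq count_predT iter_addn_0 /r -cardE card_family_prod.
have cardF i : #|F i| * q <= 2 * l i.
  apply: leq_trans (_ : (l i %/ q).+1 * q <= _).
    rewrite leq_mul2r; apply/orP; right.
    rewrite cardE -(size_map val) -(size_iota 0 (l i %/ q).+1).
    apply: uniq_leq_size; first by rewrite (map_inj_uniq val_inj) enum_uniq.
    by move=> z /mapP[a + ->]; rewrite mem_enum inE mem_iota.
  rewrite mulSn; have := leq_trunc_div (l i) q; have := min_j i isT; lia.
have : \prod_i (#|F i| * q) <= \prod_i (2 * l i) by apply: leq_prod => i _.
rewrite !big_split /= !prod_nat_const !card_ord.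
have qD : s ^ (e * D.-1) * q = q ^ D.
  by rewrite expnM -expnSr prednK.
have le_j0 : l j0 <= s * q by rewrite -expnS ltnW.
rewrite -qD; set p := \prod_(i | i != j0) l i.
have -> : \prod_i l i = l j0 * p by rewrite (bigD1 j0).
move=> prod_le.
apply: leq_trans (_ : c0 * (2 ^ D * (s * q * p)) <= _); last first.
  by rewrite -!mulnA [q * p]mulnC.
apply: leq_trans (_ : c0 * (2 ^ D * (l j0 * p)) <= _); last first.
  by rewrite !leq_mul.
apply: leq_trans (leq_mul (leqnn c0) prod_le); apply: eq_leq.
by rewrite -!mulnA; congr (_ * _); apply: mulnCA.
Qed.

End MarcusTardos.

(** * Realizers *)

Section Realizers.
Variables (d : Order.disp_t) (P : finPOrderType d).
Hypothesis P_gt0 : 0 < #|P|.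

(* Ordering by [ext_key x] is a linear extension of P in which everything not
   above x precedes x; these extensions, x ranging over P, form a realizer. *)
Definition ext_key (x y : P) : nat :=
  ((x <= y)%O * #|P|.+1 + #|[set z | (z <= y)%O]|) * #|P| + enum_rank y.

Lemma ext_key_inj x : injective (ext_key x).
Proof.
move=> y z /(congr1 (modn^~ #|P|)); rewrite /ext_key !modnMDl !modn_small ?ltn_ord //.
by move/val_inj/enum_rank_inj.
Qed.

Lemma ext_key_lt (a b : nat) (y z : P) :
  a < b -> a * #|P| + enum_rank y < b * #|P| + enum_rank z.
Proof.
move=> lt_ab; apply: leq_trans (_ : a.+1 * #|P| <= _).
  by rewrite mulSn addnC ltn_add2r ltn_ord.
by apply: leq_trans (leq_addr _ _); rewrite leq_mul2r lt_ab orbT.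
Qed.

Lemma ext_key_homo x y z : (y < z)%O -> ext_key x y < ext_key x z.
Proof.
move=> lt_yz; rewrite /ext_key.
have lt_c : #|[set w | (w <= y)%O]| < #|[set w | (w <= z)%O]|.
  apply/proper_card/properP; split.
    by apply/subsetP => w; rewrite !inE => /le_trans; apply; apply: ltW.
  by exists z; rewrite !inE ?lexx // lt_geF.
have le_x : (x <= y)%O <= (x <= z)%O.
  by case: (boolP (x <= y)%O) => // /le_trans-> //; apply: ltW.
by apply: ext_key_lt; rewrite -addnS leq_add // leq_mul2r le_x orbT.
Qed.

Lemma ext_key_split x y : ~~ (x <= y)%O -> ext_key x y < ext_key x x.
Proof.
move=> /negPf nle; apply: ext_key_lt; rewrite nle lexx mul0n mul1n add0n.
exact: leq_trans (max_card _) (leq_addr _ _).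
Qed.

Definition ext_rank (x y : P) := #|[set z | ext_key x z < ext_key x y]|.

Lemma ext_rank_ltn x y z : (ext_rank x y < ext_rank x z) = (ext_key x y < ext_key x z).
Proof.
have mono a b : ext_key x a <= ext_key x b -> ext_rank x a <= ext_rank x b.
  by move=> le_ab; apply/subset_leq_card/subsetP => w; rewrite !inE => /leq_trans; apply.
apply/idP/idP; first by apply: contraTT; rewrite -!leqNgt; apply: mono.
move=> lt_yz; apply/proper_card/properP; split.
  by apply/subsetP => w; rewrite !inE => /ltn_trans; apply.
by exists y; rewrite !inE ?ltnn.
Qed.

Lemma ext_rank_max x y : ext_rank x y < #|P|.
Proof.
rewrite -cardsT; apply/proper_card/properP; split; first exact: subsetT.
by exists y; rewrite !inE ?ltnn.
Qed.

Lemma exists_realizer : exists D, has_realizer P D.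
Proof.
exists #|P|; rewrite /has_realizer P_gt0 /=; apply/existsP.
exists [ffun i => [ffun y => Ordinal (ext_rank_max (enum_val i) y)]].
apply/andP; split.
  apply/forallP => i; apply/injectiveP => y z; rewrite !ffunE => -[eq_r].
  apply: (@ext_key_inj (enum_val i)); apply/eqP.
  by rewrite eqn_leq leqNgt -ext_rank_ltn eq_r ltnn /= leqNgt -ext_rank_ltn eq_r ltnn.
apply/forallP => p; apply/forallP => q; apply/eqP; apply/idP/forallP => [le_pq i|].
  rewrite !ffunE /= leqNgt ext_rank_ltn -leqNgt.
  by have [->//|lt_pq] := eqVneq p q; rewrite ltnW // ext_key_homo // lt_neqAle lt_pq.
(* If p is not below q, the extension attached to p places q before p. *)
move/(_ (enum_rank p)); rewrite !ffunE /= enum_rankK; apply: contraTT => nle.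
by rewrite -ltnNge ext_rank_ltn ext_key_split.
Qed.

Lemma dimension_realizer : exists2 L : 'I_(dimension P) -> P -> 'I_#|P|,
  0 < dimension P & (forall i, injective (L i)) /\
  (forall p q, (p <= q)%O = [forall i, L i p <= L i q]).
Proof.
have : has_realizer P (dimension P).
  rewrite /dimension; case: ClassicalEpsilon.excluded_middle_informative => [H|[]].
    by case: ex_minnP.
  exact: exists_realizer.
case/andP => D_gt0 /existsP[L /andP[/forallP Linj /forallP LP]].
exists (fun i p => L i p) => //; split=> [i|p q]; first exact/injectiveP.
by apply/eqP; apply: (forallP (LP p)).
Qed.

End Realizers.

(** * Partition of the grid into boxes *)

Section Blocks.
Variables (n k D : nat).
Hypotheses (k_gt0 : 0 < k).
Variable blk : 'I_n -> 'I_D.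
Implicit Types x y : grid n k.

Definition block j : {set 'I_n} := [set i | blk i == j].
Definition block_seq x j : seq nat := [seq (x i : nat) | i <- enum (block j)].

Lemma size_block_seq x j : size (block_seq x j) = #|block j|.
Proof. by rewrite size_map -cardE. Qed.

Lemma bounded_block_seq x j : bounded k.-1 (block_seq x j).
Proof. by apply/allP => _ /mapP[i _ ->]; apply: ord_le_pred. Qed.

Lemma sumn_block_seq x j : sumn (block_seq x j) = \sum_(i in block j) (x i : nat).
Proof. by rewrite sumnE big_map big_enum. Qed.

Lemma block_seq_glue (z : 'I_D -> seq nat) :
  (forall j, bounded k.-1 (z j)) -> (forall j, size (z j) = #|block j|) ->
  exists x, forall j, block_seq x j = z j.
Proof.
move=> bz sz.
have lt_k i : nth 0 (z (blk i)) (index i (enum (block (blk i)))) < k.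
  rewrite -(prednK k_gt0) ltnS; have /(all_nthP 0) := bz (blk i); apply.
  by rewrite sz cardE index_mem mem_enum inE.
exists [ffun i => Ordinal (lt_k i)] => j.
apply: (@eq_from_nth _ 0); first by rewrite size_block_seq sz.
move=> p; rewrite size_block_seq cardE => lt_p.
have [i0 _] : exists i : 'I_n, True by move: lt_p; case: (enum _) => // i; exists i.
rewrite (nth_map i0) // ffunE /=.
have : nth i0 (enum (block j)) p \in enum (block j) by exact: mem_nth.
by rewrite mem_enum inE => /eqP->; rewrite index_uniq ?enum_uniq.
Qed.

Lemma gle_block_seq x y : (forall j, all2 leq (block_seq x j) (block_seq y j)) -> gle x y.
Proof.
move=> le_xy; apply/forallP => i; have := le_xy (blk i).
rewrite /block_seq; have : i \in enum (block (blk i)) by rewrite mem_enum inE.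
by elim: (enum _) => //= a e IH; rewrite inE => /orP[/eqP<-|/IH{}IH] /andP[].
Qed.

(** [labels x] names the product of chains containing x, and [positions x] gives the coordinates of
    x in that box. *)
Definition labels x : {ffun 'I_D -> seq nat} :=
  [ffun j => chain_label k.-1 (block_seq x j)].
Definition positions x : {ffun 'I_D -> nat} :=
  [ffun j => chain_pos k.-1 (block_seq x j)].

(** With equal labels, block sums and positions differ by a constant, so the grid order implies the
    order of positions; the converse is [chain_leq] in each block. *)
Lemma gle_positions x y : labels x = labels y ->
  gle x y = [forall j, positions x j <= positions y j].
Proof.
move=> /ffunP eq_l; have {}eq_l j := eq_l j; apply/idP/forallP => [/forallP le_xy j|le_p].
  have := eq_l j; rewrite !ffunE => lj; rewrite -(leq_add2r (sumn (chain_label k.-1 (block_seq x j)))).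
  rewrite [in leqRHS]lj -!sumn_chain ?bounded_block_seq // !sumn_block_seq.
  by apply: leq_sum.
apply: gle_block_seq => j; have := eq_l j; have := le_p j; rewrite !ffunE => le_j lj.
by apply: chain_leq le_j; rewrite ?bounded_block_seq // !size_block_seq.
Qed.

Definition label_box (l : {ffun 'I_D -> seq nat}) j := (chain_height k.-1 (l j)).+1.

Definition mid_block j x :=
  \sum_(i in block j) (x i : nat) == (#|block j| * k.-1)./2.

(* The product counts the points of the box whose j-th coordinate is half the
   height of the chain, and these lie in the middle level of block j. *)
Lemma prod_label_box x j :
  \prod_(i | i != j) label_box (labels x) i
  <= #|[set y | (labels y == labels x) && mid_block j y]|.
Proof.
set l := labels x; pose H := \sum_i label_box l i.
have le_H i : label_box l i <= H.+1 by rewrite ltnW // ltnS /H (bigD1 i) //= leq_addr.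
pose F i : {set 'I_H.+1} := [set a : 'I_H.+1 |
  if i == j then a == (chain_height k.-1 (l j))./2 :> nat else a < label_box l i].
have half_lt : (chain_height k.-1 (l j))./2 < H.+1.
  apply: leq_trans (le_H j); rewrite /label_box ltnS; lia.
have cardF i : i != j -> #|F i| = label_box l i.
  move=> ne_ij; have wi : injective (widen_ord (le_H i)).
    by move=> a b /(congr1 val) /= /val_inj.
  rewrite -[RHS]card_ord -(card_imset _ wi).
  apply: eq_card => a; rewrite inE (negPf ne_ij); apply/idP/imsetP.
    by move=> lt_a; exists (Ordinal lt_a) => //; apply: val_inj.
  by move=> [b _ ->] /=.
have cardFj : #|F j| = 1.
  rewrite -(cards1 (Ordinal half_lt)); apply: eq_card => a.
  by rewrite !inE eqxx.
have -> : \prod_(i | i != j) label_box l i = \prod_i #|F i|.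
  by rewrite [RHS](bigD1 j) //= cardFj mul1n; apply: eq_bigr => i /cardF.
rewrite -card_family_prod.
pose pos y : {ffun 'I_D -> 'I_H.+1} := [ffun i => inord (positions y i)].
apply: leq_trans (leq_imset_card pos _).
apply/subset_leq_card/subsetP => f; rewrite inE => /forallP fF.
have le_f i : f i <= chain_height k.-1 (chain_label k.-1 (block_seq x i)).
  have := fF i; rewrite inE /label_box /l !ffunE; case: eqP => [->/eqP->|//]; lia.
have /fin_all_exists[z zP] i := chain_fill (bounded_block_seq x i) (le_f i).
have [y yz] : exists y, forall i, block_seq y i = z i.
  by apply: block_seq_glue => i; have [? sz _ _] := zP i; rewrite // sz size_block_seq.
have ly : labels y = l.
  by apply/ffunP => i; rewrite !ffunE yz; have [] := zP i.
have py i : positions y i = f i by rewrite ffunE yz; have [] := zP i.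
apply/imsetP; exists y; last first.
  by apply/ffunP => i; apply: val_inj; rewrite ffunE /= py inordK.
rewrite inE ly eqxx /= /mid_block -sumn_block_seq -(size_block_seq y j).
apply/eqP/sumn_chain_mid; first exact: bounded_block_seq.
have := py j; rewrite !ffunE => ->; have := fF j; rewrite inE eqxx => /eqP->.
by rewrite -ly ffunE.
Qed.

(** Boxes with different labels are disjoint, so each point of the middle level of block j is
    counted at most once. *)
Lemma sum_prod_label_box j (r : seq {ffun 'I_D -> seq nat}) : uniq r ->
  (forall l, l \in r -> exists x, labels x = l) ->
  \sum_(l <- r) \prod_(i | i != j) label_box l i <= #|[set y | mid_block j y]|.
Proof.
move=> ur imr.
apply: leq_trans (_ : \sum_(l <- r) \sum_(y | mid_block j y) (labels y == l) <= _).
  rewrite big_seq [leqRHS]big_seq; apply: leq_sum => l /imr[x <-].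
  apply: leq_trans (prod_label_box x j) _.
  rewrite -sum1_card big_mkcond [leqRHS]big_mkcond; apply: leq_sum => y _.
  by rewrite inE andbC; case: mid_block => //=; case: eqP.
rewrite exchange_big -sum1_card /= [leqRHS](eq_bigl (mid_block j)); last by move=> y; rewrite inE.
apply: leq_sum => y _; apply: leq_trans (leq_b1 (labels y \in r)).
rewrite -(count_uniq_mem _ ur).
by rewrite -sumn_count sumnE big_map; apply: leq_sum => l _; rewrite /= eq_sym.
Qed.

(** S is split by labels; [positions] is injective on each part by antisymmetry, and a pattern among
    positions lifts to points of S in one box. *)
Lemma card_le_label_boxes (P : finType) (L : 'I_D -> P -> 'I_#|P|) c (S : {set grid n k}) :
  (forall (l : 'I_D -> nat) A, (forall i, 0 < l i) -> uniq A -> all (in_box l) A ->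
     ~ contains_pattern L [set: 'I_D] A ->
     size A <= c * \sum_j \prod_(i | i != j) l i) ->
  (forall g : P -> grid n k, (forall p, g p \in S) ->
     (forall p q, labels (g p) = labels (g q)) ->
     (forall i p q, L i p < L i q -> positions (g p) i < positions (g q) i) -> False) ->
  #|S| <= c * \sum_j #|[set y | mid_block j y]|.
Proof.
move=> boxb noP; pose r := undup [seq labels x | x <- enum S].
have labr : {in enum S, forall x, labels x \in r}.
  by move=> x xS; rewrite mem_undup map_f.
rewrite cardE; apply: leq_trans (size_le_sum_fibers labr) _.
have fib l : count (fun x => labels x == l) (enum S)
    <= c * \sum_j \prod_(i | i != j) label_box l i.
  rewrite -size_filter -(size_map positions); set G := filter _ _.
  have GP x : x \in G -> labels x = l /\ x \in S.
    by rewrite mem_filter mem_enum => /andP[/eqP].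
  apply: boxb => [i||| [f [fG fL]]] //.
  - rewrite map_inj_in_uniq; first exact: filter_uniq (enum_uniq _).
    move=> x y /GP[lx _] /GP[ly _] eq_p.
    apply/ffunP => i; apply/val_inj/eqP; rewrite eqn_leq.
    have le_xy : gle x y by rewrite gle_positions ?lx // eq_p; apply/forallP.
    have le_yx : gle y x by rewrite gle_positions ?lx // eq_p; apply/forallP.
    by rewrite (forallP le_xy) (forallP le_yx).
  - apply/allP => _ /mapP[x /GP[<- _] ->]; apply/forallP => i.
    by rewrite /label_box ltnS !ffunE chain_pos_le // bounded_block_seq.
  have ex p : exists2 x, x \in G & positions x = f p.
    by have /mapP[x xG ->] := fG p; exists x.
  have /fin_all_exists2[g gG gf] := ex.
  apply: (noP g) => [p|p q|i p q lt_pq]; first by have [] := GP _ (gG p).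
    by have [-> _] := GP _ (gG p); have [-> _] := GP _ (gG q).
  by rewrite !gf fL // inE.
apply: leq_trans (leq_sum _ (fun l _ => fib l)) _.
rewrite -big_distrr leq_mul2l /= exchange_big /=; apply/orP; right.
apply: leq_sum => j _; apply: sum_prod_label_box; first exact: undup_uniq.
by move=> l; rewrite mem_undup => /mapP[x _ ->]; exists x.
Qed.

End Blocks.

(** * Residue classes as blocks, and the final bound *)

Lemma card_residue_class n D (D_gt0 : 0 < D) (j : 'I_D) :
  n %/ D <= #|block (fun i : 'I_n => Ordinal (ltn_pmod i D_gt0)) j|.
Proof.
have lt_n (a : 'I_(n %/ D)) : a * D + j < n.
  apply: leq_trans (leq_trunc_div n D).
  by apply: leq_trans (_ : a.+1 * D <= _); rewrite ?leq_mul2r ?ltn_ord ?orbT // mulSn addnC ltn_add2r.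
pose f a := Ordinal (lt_n a).
have f_inj : injective f.
  move=> a b /(congr1 val) /= /addIn/eqP; rewrite eqn_pmul2r // => /eqP; exact: val_inj.
rewrite -[X in X <= _]card_ord -(card_imset _ f_inj).
apply/subset_leq_card/subsetP => _ /imsetP[a _ ->].
by rewrite inE; apply/eqP/val_inj; rewrite /= modnMDl modn_small.
Qed.

Theorem theorem2 (d : Order.disp_t) (P : finPOrderType d) :
  exists C : nat, forall k n : nat, (0 < k)%N -> (0 < n)%N ->
    (dimension P <= n)%N ->
    forall S : {set grid n k}, ~ has_copy P S ->
      (#|S| <= C * grid_width n k)%N.
Proof.
have [P0|P_gt0] := posnP #|P|.
  (* The empty set is a copy of the empty poset, so no S avoids it. *)
  exists 0 => k n _ _ _ S []; exists set0; split; first exact: sub0set.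
  have absurd (p : P) : False by have := card0_eq P0 p; rewrite inE.
  exists (fun p => False_rect _ (absurd p)).
  by split=> [p||p]; [case: (absurd p)| apply/setP => x; rewrite inE; apply/imsetP => -[p]; case: (absurd p)|case: (absurd p)].
have [L D_gt0 [L_inj LP]] := dimension_realizer P_gt0.
set D := dimension P in L D_gt0 L_inj LP *.
have [c boxb] := box_bound L P_gt0 D_gt0.
exists (c * (D * 8 ^ (D * 2))) => k n k_gt0 n_gt0 le_Dn S noP.
pose blk (i : 'I_n) := Ordinal (ltn_pmod i D_gt0).
(* Since D <= n, n < (n/D + 1) D <= 2D (n/D) <= 2^(2D) (n/D), so 2D doublings of a block reach n
   coordinates. *)
have mid j : #|[set y : grid n k | mid_block blk j y]| <= 8 ^ (D * 2) * grid_width n k.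
  rewrite card_block_level mulnC; apply: level_size_width => //.
    by rewrite -[leqRHS]card_ord max_card.
  have le_j := card_residue_class n D_gt0 j.
  have q_gt0 : 0 < n %/ D by rewrite divn_gt0.
  have lt_n := ltn_ceil n D_gt0.
  apply: leq_trans (leq_mul (ltnW (ltn_expl (D * 2) (ltnSn 1))) le_j).
  apply: leq_trans (ltnW lt_n) _; rewrite mulnC -mulnA leq_mul2l mul2n -addnn.
  by rewrite -addn1 leq_add2l q_gt0 orbT.
apply: leq_trans (card_le_label_boxes (blk := blk) k_gt0 boxb _) _.
  move=> g gS eq_lab lt_pos; apply: noP.
  (* Each [L i] is injective, so the strict implications between [L i] and positions amount to an
     equivalence of the weak orders. *)
  have gE p q : (p <= q)%O = gle (g p) (g q).
    rewrite (gle_positions (eq_lab p q)) LP; apply: eq_forallb => i.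
    apply/idP/idP; last by apply: contraTT; rewrite -!ltnNge; apply: lt_pos.
    rewrite leq_eqVlt => /orP[/eqP/val_inj/L_inj->//|/lt_pos]; exact: ltnW.
  have g_inj : injective g.
    by move=> p q eq_g; apply: le_anti; rewrite !gE eq_g; apply/andP; split; apply/forallP.
  exists (g @: [set: P]); split; first by apply/subsetP => _ /imsetP[p _ ->].
  by exists g.
rewrite -!mulnA leq_mul2l; apply/orP; right.
apply: leq_trans (leq_sum _ (fun j _ => mid j)) _.
by rewrite sum_nat_const card_ord.
Qed.
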